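(* For $n\in\mathbb{N}$ let $\delta_n=e^{-\frac{1}{n+1}}\sqrt{e^{\frac{1}{n+1}}-1}$ and $p_n=\frac12+(-1)^n\delta_n$, and let $\gamma_{\sim 1/2}$ be the precise forecasting system defined by $\gamma_{\sim 1/2}(z_1,\dots,z_{n-1})=p_n$ for all $n\in\mathbb{N}$ and $(z_1,\dots,z_{n-1})\in\Omega^\lozenge$. Consider any $\omega\in\Omega$ that is computably random for $\gamma_{\sim 1/2}$. Then for all $I\in\mathcal{C}$: $I\in\mathcal{C}_{\mathrm{C}}(\omega)$ if and only if $\min I<\frac12$ and $\max I>\frac12$.
   Context: $\mathbb{N}=\{1,2,\dots\}$, $\mathbb{N}_0=\mathbb{N}\cup\{0\}$. $\mathcal{C}$ is the set of all non-empty closed subintervals of $[0,1]$ (interval forecasts). For $I\in\mathcal{C}$ and $f\colon\{0,1\}\to\mathbb{R}$, $\overline{E}_I(f)=\max_{p\in I}[pf(1)+(1-p)f(0)]$. $\Omega=\{0,1\}^{\mathbb{N}}$ is the set of outcome sequences and $\Omega^\lozenge=\bigcup_{n\in\mathbb{N}_0}\{0,1\}^n$ the set of situations, with $\square$ the empty sequence. For $\omega\in\Omega$, $\omega^n$ is its initial segment of length $n$. A forecasting system is a map $\gamma\colon\Omega^\lozenge\to\mathcal{C}$; it is precise if all its values are one-point intervals, and a number $p\in[0,1]$ is identified with $\{p\}\in\mathcal{C}$. (One has $\delta_n\in(0,\frac12)$ and $p_n\in(0,1)$ for all $n\in\mathbb{N}$.) A real process is a map $F\colon\Omega^\lozenge\to\mathbb{R}$,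 with process difference $\Delta F(s)(x)=F(sx)-F(s)$. A supermartingale for $\gamma$ is a real process $M$ with $\overline{E}_{\gamma(s)}(\Delta M(s))\le 0$ for all $s\in\Omega^\lozenge$; a test supermartingale for $\gamma$ is a non-negative supermartingale $T$ for $\gamma$ with $T(\square)=1$. A real process $F$ is computable if there are rational numbers $r_{s,n}=(-1)^{\sigma(s,n)}a(s,n)/b(s,n)$, with $a,b,\sigma\colon\Omega^\lozenge\times\mathbb{N}_0\to\mathbb{N}_0$ computable and $b>0$, and a computable function $e\colon\Omega^\lozenge\times\mathbb{N}_0\to\mathbb{N}_0$, such that $n\ge e(s,N)$ implies $|r_{s,n}-F(s)|\le 2^{-N}$ for all $s,n,N$. An outcome sequence $\omega$ is computably random for $\gamma$ if $\sup_{n\in\mathbb{N}}T(\omega^n)<+\infty$ for every computable test supermartingale $T$ for $\gamma$. For $I\in\mathcal{C}$, the stationary forecasting system $\gamma_I$ is given by $\gamma_I(s)=I$ for all $s\in\Omega^\lozenge$, and $\mathcal{C}_{\mathrm{C}}(\omega)=\{I\in\mathcal{C}\colon\omega\text{ is computably random for }\gamma_I\}$. *)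

(* Defs.v *)
From mathcomp Require Import all_boot all_order all_algebra.
From mathcomp Require Import all_classical all_reals all_analysis.
From mathcomp Require Import ring lra.

Set Implicit Arguments.
Unset Strict Implicit.
Unset Printing Implicit Defensive.

Import Order.TTheory GRing.Theory Num.Theory.

Local Open Scope classical_set_scope.
Local Open Scope ring_scope.

(* Computability is formalized through Kleene's partial (mu-)recursive
   functions.  Programs are not indexed by their arity; a program run on an
   argument list it does not fit has no value. *)
Inductive recfun : Type :=
| RZero
| RSucc
| RProj of nat
| RComp of recfun & seq recfun
| RPrim of recfun & recfun
| RMin of recfun.

(* [receval f xs y]: the program [f] halts on [xs] with result [y]. *)
Inductive receval : recfun -> seq nat -> nat -> Prop :=
| receval_zero xs : receval RZero xs 0%N
| receval_succ x xs : receval RSucc (x :: xs) x.+1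
| receval_proj i xs : (i < size xs)%N -> receval (RProj i) xs (nth 0%N xs i)
| receval_comp f gs xs ys y :
    recevals gs xs ys -> receval f ys y -> receval (RComp f gs) xs y
| receval_prim0 f g xs y :
    receval f xs y -> receval (RPrim f g) (0%N :: xs) y
| receval_primS f g n xs z y :
    receval (RPrim f g) (n :: xs) z -> receval g (n :: z :: xs) y ->
    receval (RPrim f g) (n.+1 :: xs) y
| receval_min f xs n :
    (forall m, (m < n)%N -> exists k, receval f (m :: xs) k.+1) ->
    receval f (n :: xs) 0%N -> receval (RMin f) xs n
with recevals : seq recfun -> seq nat -> seq nat -> Prop :=
| recevals_nil xs : recevals [::] xs [::]
| recevals_cons g gs xs y ys :
    receval g xs y -> recevals gs xs ys -> recevals (g :: gs) xs (y :: ys).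

(* The outcomes 1 and 0 are [true] and [false]. *)
Definition situation := seq bool.

(* [omega k] is the outcome number [k + 1]. *)
Definition outcome_sequence := nat -> bool.

Definition initial (omega : outcome_sequence) (n : nat) : situation :=
  mkseq omega n.

(* Goedel number of [z_1 ... z_n]: the number whose binary expansion is
   [1 z_1 ... z_n]; a bijection onto the positive naturals. *)
Definition situation_code (s : situation) : nat :=
  foldl (fun (c : nat) (z : bool) => c.*2 + z)%N 1%N s.

Definition computable_nat (a : situation -> nat -> nat) : Prop :=
  exists f : recfun, forall s n, receval f [:: situation_code s; n] (a s n).

Definition computable_rat (r : situation -> nat -> rat) : Prop :=
  exists a b sigma : situation -> nat -> nat,
    [/\ computable_nat a, computable_nat b, computable_nat sigma &
        forall s n, (0 < b s n)%N /\
          r s n = (-1) ^+ sigma s n * ((a s n)%:R / (b s n)%:R)].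

Record interval_forecast (R : realType) := IntervalForecast {
  imin : R;
  imax : R;
  imin_ge0 : 0 <= imin;
  imin_le_imax : imin <= imax;
  imax_le1 : imax <= 1 }.

Section Randomness.
Variable R : realType.

Definition forecast_set (I : interval_forecast R) : set R :=
  `[imin I, imax I].

Definition point_forecast (p : R) (p_ge0 : 0 <= p) (p_le1 : p <= 1) :
  interval_forecast R := IntervalForecast p_ge0 (lexx p) p_le1.

(* The maximum is attained, as [forecast_set I] is compact and nonempty. *)
Definition upper_expectation (I : interval_forecast R) (f : bool -> R) : R :=
  sup [set p * f true + (1 - p) * f false | p in forecast_set I].

Definition forecasting_system := situation -> interval_forecast R.

Definition stationary (I : interval_forecast R) : forecasting_system :=
  fun=> I.

Definition real_process := situation -> R.

Definition process_difference (F : real_process) (s : situation) : bool -> R :=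
  fun x => F (rcons s x) - F s.

Definition supermartingale (gamma : forecasting_system) (M : real_process) :=
  forall s, upper_expectation (gamma s) (process_difference M s) <= 0.

Definition test_supermartingale (gamma : forecasting_system)
    (T : real_process) :=
  [/\ supermartingale gamma T, forall s, 0 <= T s & T [::] = 1].

Definition computable_process (F : real_process) : Prop :=
  exists (r : situation -> nat -> rat) (e : situation -> nat -> nat),
    [/\ computable_rat r, computable_nat e &
        forall s n N, (e s N <= n)%N -> `|ratr (r s n) - F s| <= 2 ^- N].

Definition computably_random (gamma : forecasting_system)
    (omega : outcome_sequence) : Prop :=
  forall T : real_process,
    computable_process T -> test_supermartingale gamma T ->
    (ereal_sup [set (T (initial omega n))%:E | n in [set n | (0 < n)%N]]
      < +oo)%E.

Definition computable_forecasts (omega : outcome_sequence) :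
  set (interval_forecast R) :=
  [set I | computably_random (stationary I) omega].

Definition delta (n : nat) : R :=
  expR (- (n.+1%:R)^-1) * Num.sqrt (expR (n.+1%:R)^-1 - 1).

Definition forecast_p (n : nat) : R := 2^-1 + (-1) ^+ n * delta n.

Lemma delta_ge0 n : 0 <= delta n.
Proof. by rewrite mulr_ge0 ?expR_ge0 ?sqrtr_ge0. Qed.

Lemma delta_le_half n : delta n <= 2^-1.
Proof.
have d0 := delta_ge0 n.
suff : delta n ^+ 2 <= 2^-1 ^+ 2 by rewrite ler_pXn2r ?nnegrE ?invr_ge0.
set q : R := expR (- (n.+1%:R)^-1).
have qE : q * expR (n.+1%:R)^-1 = 1 by rewrite /q -expRD addNr expR0.
have e1 : 0 <= expR (n.+1%:R)^-1 - 1 :> R.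
  by rewrite subr_ge0 -[leLHS]expR0 ler_expR invr_ge0.
rewrite /delta exprMn sqr_sqrtr // -/q.
have -> : q ^+ 2 * (expR (n.+1%:R)^-1 - 1)
        = q * (q * expR (n.+1%:R)^-1) - q ^+ 2 by ring.
rewrite qE mulr1; have := sqr_ge0 (q - 2^-1); lra.
Qed.

Lemma forecast_p_itv n : 0 <= forecast_p n /\ forecast_p n <= 1.
Proof.
have d0 := delta_ge0 n; have d1 := delta_le_half n.
by rewrite /forecast_p -signr_odd; case: (odd n); rewrite ?expr1 ?expr0; split; lra.
Qed.

(* In the situation [z_1 ... z_(n-1)] the forecast is [p_n]. *)
Definition gamma_half : forecasting_system := fun s =>
  let n := (size s).+1 in
  point_forecast (proj1 (forecast_p_itv n)) (proj2 (forecast_p_itv n)).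

End Randomness.

Arguments gamma_half R : clear implicits.

(* Main.v *)
(* If 1/2 is interior to I, then p_n lies in I from some time N on, so a test
   supermartingale for I, rescaled and started at time N, is one for gamma_{~1/2}
   and hence bounded on omega.

   If I lies on one side of 1/2, say min I >= 1/2, bet the fraction c_k = 1/m_k
   of the capital on outcome 0 at every odd time k, where p_k = 1/2 - delta_k and
   m_k is about sqrt (6 k), so that c_k <= delta_k.  The capital T is a test
   supermartingale for I, with factors 1 + c_k and 1 - c_k.  The process S with
   factors (1 + c_k^2) / (1 + c_k) and (1 + c_k^2) / (1 - c_k) is a test
   supermartingale for gamma_{~1/2}, because
   (1 + c^2) (1 - 2 delta c) <= 1 - c^2 when c <= delta.  Since
   S T = prod (1 + c_k^2) diverges and S is bounded on omega, T is not.
   Both processes are rational valued, which makes them computable exactly. *)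
Require Import Defs.
From mathcomp Require Import all_boot all_order all_algebra.
From mathcomp Require Import all_classical all_reals all_analysis.
From mathcomp Require Import ring lra zify.

Import Order.TTheory GRing.Theory Num.Theory.

(** * Closure properties of the recursive functions *)

(** The encoding [enc] turns an input of any shape into an argument list, so that one set of closure
    rules serves numbers, tuples of numbers and situations. *)
Definition computes {X : Type} (enc : X -> seq nat) (F : X -> nat) : Prop :=
  exists f, forall x, receval f (enc x) (F x).

Lemma eq_computes {X : Type} {enc : X -> seq nat} {F : X -> nat} (G : X -> nat) :
  F =1 G -> computes enc F -> computes enc G.
Proof. by move=> FG [f fP]; exists f => x; rewrite -FG. Qed.

Lemma computes_nth {X : Type} (enc : X -> seq nat) (i : nat) :
  (forall x, i < size (enc x))%N -> computes enc (fun x => nth 0%N (enc x) i).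
Proof. by move=> i_lt; exists (RProj i) => x; constructor. Qed.

Lemma computes_comp {X : Type} {enc : X -> seq nat} {F : nat -> nat}
    {G : X -> nat} :
  computes (fun n => [:: n]) F -> computes enc G ->
  computes enc (fun x => F (G x)).
Proof.
move=> [f fP] [g gP]; exists (RComp f [:: g]) => x.
by apply: (@receval_comp _ _ _ [:: G x]) => //; do !constructor.
Qed.

Lemma computes_comp2 {X : Type} {enc : X -> seq nat} {F : nat -> nat -> nat}
    {G1 G2 : X -> nat} :
  computes (fun t : nat * nat => [:: t.1; t.2]) (fun t => F t.1 t.2) ->
  computes enc G1 -> computes enc G2 -> computes enc (fun x => F (G1 x) (G2 x)).
Proof.
move=> [f fP] [g1 g1P] [g2 g2P]; exists (RComp f [:: g1; g2]) => x.
apply: (@receval_comp _ _ _ [:: G1 x; G2 x]); first by do !constructor.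
exact: (fP (G1 x, G2 x)).
Qed.

Lemma computes_const {X : Type} (enc : X -> seq nat) (n : nat) :
  computes enc (fun=> n).
Proof.
elim: n => [|n IHn]; first by exists RZero => x; constructor.
have succP : computes (fun n => [:: n]) succn by exists RSucc => m; constructor.
exact: computes_comp succP IHn.
Qed.

Lemma computes_succ {X : Type} {enc : X -> seq nat} {F : X -> nat} :
  computes enc F -> computes enc (fun x => (F x).+1).
Proof. by apply: computes_comp; exists RSucc => n; constructor. Qed.

Lemma computes_if {X : Type} {enc : X -> seq nat} {B : X -> bool}
    {F G : X -> nat} :
  computes enc (fun x => nat_of_bool (B x)) ->
  computes enc F -> computes enc G ->
  computes enc (fun x => if B x then F x else G x).
Proof.
move=> [b bP] [f fP] [g gP].
(* The boolean is the recursion variable. At 0, [RProj 1] reads [G x] in [[F x; G x]]; at 1, the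
   counter and the previous value come first, so [RProj 2] reads [F x]. *)
exists (RComp (RPrim (RProj 1) (RProj 2)) [:: b; f; g]) => x.
apply: (@receval_comp _ _ _ [:: nat_of_bool (B x); F x; G x]).
  by do !constructor.
case: (B x) => /=; last by constructor; apply: (@receval_proj 1 [:: F x; G x]).
apply: (@receval_primS _ _ _ _ (G x)).
  by constructor; apply: (@receval_proj 1 [:: F x; G x]).
exact: (@receval_proj 2 [:: 0%N; G x; F x; G x]).
Qed.

Lemma computes_bool {X : Type} {enc : X -> seq nat} {B : X -> bool}
    (F : bool -> nat) :
  computes enc (fun x => nat_of_bool (B x)) -> computes enc (fun x => F (B x)).
Proof.
move=> BP.
apply: (eq_computes (F := fun x => if B x then F true else F false)).
  by move=> x; case: (B x).
by apply: computes_if => //; apply: computes_const.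
Qed.

Lemma computes_prim {X : Type} {enc : X -> seq nat} {H : nat -> X -> nat}
    (G : nat -> nat -> X -> nat) :
  (forall n x, H n.+1 x = G n (H n x) x) ->
  computes enc (H 0%N) ->
  computes (fun t : nat * nat * X => [:: t.1.1, t.1.2 & enc t.2])
    (fun t => G t.1.1 t.1.2 t.2) ->
  computes (fun t : nat * X => t.1 :: enc t.2) (fun t => H t.1 t.2).
Proof.
move=> HS [f fP] [g gP]; exists (RPrim f g) => -[n x] /=.
elim: n => [|n IHn]; first by constructor.
apply: (@receval_primS _ _ _ _ _ _ IHn).
by rewrite HS; apply: (gP (n, H n x, x)).
Qed.

Lemma computes_prim1 {H : nat -> nat} (G : nat -> nat -> nat) :
  (forall n, H n.+1 = G n (H n)) ->
  computes (fun t : nat * nat => [:: t.1; t.2]) (fun t => G t.1 t.2) ->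
  computes (fun n => [:: n]) H.
Proof.
move=> HS [g gP].
have [] := @computes_prim unit (fun=> [::]) (fun n=> fun=> H n)
  (fun n z => fun=> G n z).
- by [].
- exact: computes_const.
- by exists g => -[[n z] []]; apply: (gP (n, z)).
by move=> f fP; exists f => n; apply: (fP (n, tt)).
Qed.

Lemma computes_min {X : Type} {enc : X -> seq nat} {m : X -> nat}
    (P : nat -> X -> nat) :
  (forall x, P (m x) x = 0%N) -> (forall x i, i < m x -> 0 < P i x)%N ->
  computes (fun t : nat * X => t.1 :: enc t.2) (fun t => P t.1 t.2) ->
  computes enc m.
Proof.
move=> Pm Pmin [f fP]; exists (RMin f) => x; constructor.
  move=> i /Pmin; case E: (P i x) => [//|k] _; exists k.
  by rewrite -E; apply: (fP (i, x)).
by rewrite -(Pm x); apply: (fP (m x, x)).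
Qed.

Lemma computes_fst : computes (fun t : nat * nat => [:: t.1; t.2]) fst.
Proof. exact: (computes_nth (fun t : nat * nat => [:: t.1; t.2]) 0). Qed.

Lemma computes_snd : computes (fun t : nat * nat => [:: t.1; t.2]) snd.
Proof. exact: (computes_nth (fun t : nat * nat => [:: t.1; t.2]) 1). Qed.

Lemma computes_id : computes (fun n => [:: n]) id.
Proof. exact: (computes_nth (fun n : nat => [:: n]) 0). Qed.

Lemma computes_prim2 {H : nat -> nat -> nat} (G : nat -> nat -> nat -> nat) :
  (forall n m, H n.+1 m = G n (H n m) m) ->
  computes (fun n => [:: n]) (H 0%N) ->
  computes (fun t : nat * nat * nat => [:: t.1.1; t.1.2; t.2])
    (fun t => G t.1.1 t.1.2 t.2) ->
  computes (fun t : nat * nat => [:: t.1; t.2]) (fun t => H t.1 t.2).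
Proof. exact: computes_prim. Qed.

(** * Recursive arithmetic, up to products along a branch *)

Local Notation enc3 := (fun t : nat * nat * nat => [:: t.1.1; t.1.2; t.2]).

Lemma computes_acc : computes enc3 (fun t => t.1.2).
Proof. exact: (computes_nth enc3 1). Qed.

Lemma computes_param : computes enc3 (fun t => t.2).
Proof. exact: (computes_nth enc3 2). Qed.

Lemma computes_add {X : Type} {enc : X -> seq nat} {F G : X -> nat} :
  computes enc F -> computes enc G -> computes enc (fun x => F x + G x)%N.
Proof.
apply: computes_comp2; apply: (computes_prim2 (fun _ z _ => z.+1)).
- exact: addSn.
- exact: computes_id.
- exact: (computes_succ computes_acc).
Qed.

Lemma computes_mul {X : Type} {enc : X -> seq nat} {F G : X -> nat} :
  computes enc F -> computes enc G -> computes enc (fun x => F x * G x)%N.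
Proof.
apply: computes_comp2; apply: (computes_prim2 (fun _ z m => m + z)%N).
- exact: mulSn.
- exact: computes_const.
- exact: computes_add computes_param computes_acc.
Qed.

Lemma computes_pred {X : Type} {enc : X -> seq nat} {F : X -> nat} :
  computes enc F -> computes enc (fun x => (F x).-1).
Proof.
apply: computes_comp; apply: (computes_prim1 (fun n _ => n)) => //.
exact: computes_fst.
Qed.

Lemma computes_sub {X : Type} {enc : X -> seq nat} {F G : X -> nat} :
  computes enc F -> computes enc G -> computes enc (fun x => F x - G x)%N.
Proof.
(* Recursion is on the first argument, so the arguments are swapped and the predecessor is
   iterated. *)
move=> FP GP; apply: (computes_comp2 (F := fun m n => n - m)%N _ GP FP).
apply: (computes_prim2 (H := fun m n => n - m)%N (fun _ z _ => z.-1)).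
- by move=> n m; rewrite subnS.
- by apply: eq_computes computes_id => n; rewrite subn0.
- exact: computes_pred computes_acc.
Qed.

Lemma computes_leq {X : Type} {enc : X -> seq nat} {F G : X -> nat} :
  computes enc F -> computes enc G ->
  computes enc (fun x => nat_of_bool (F x <= G x)%N).
Proof.
move=> FP GP.
apply: (eq_computes (F := fun x => 1 - (F x - G x))%N).
  by move=> x /=; case: leqP; lia.
apply: computes_sub; first exact: computes_const.
exact: computes_sub.
Qed.

Lemma computes_odd {X : Type} {enc : X -> seq nat} {F : X -> nat} :
  computes enc F -> computes enc (fun x => nat_of_bool (odd (F x))).
Proof.
apply: (computes_comp (F := fun n => nat_of_bool (odd n))).
apply: (computes_prim1 (fun _ z => 1 - z)%N) => [n /=|]; first by case: (odd n).
by apply: computes_sub computes_snd; apply: computes_const.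
Qed.

Lemma computes_half {X : Type} {enc : X -> seq nat} {F : X -> nat} :
  computes enc F -> computes enc (fun x => (F x)./2).
Proof.
apply: computes_comp; apply: (computes_prim1 (fun n z => odd n + z)%N).
  by move=> n; rewrite -uphalf_half.
exact: computes_add (computes_odd computes_fst) computes_snd.
Qed.

Lemma computes_iter_half {X : Type} {enc : X -> seq nat} {F G : X -> nat} :
  computes enc F -> computes enc G ->
  computes enc (fun x => iter (F x) half (G x)).
Proof.
apply: (computes_comp2 (F := fun m n => iter m half n)).
apply: (computes_prim2 (H := fun m n => iter m half n) (fun _ z _ => z./2)) => //.
  exact: computes_id.
exact: (computes_half computes_acc).
Qed.

Lemma iter_half m n : iter m half n = (n %/ 2 ^ m)%N.
Proof.
by elim: m => [|m /= ->]; rewrite ?divn1 // -divn2 -divnMA expnSr.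
Qed.

(** The logarithm is the least [i] for which [i.+1] halvings give 0; this includes the default value
    0 at [n = 0]. *)
Lemma computes_log2 {X : Type} {enc : X -> seq nat} {F : X -> nat} :
  computes enc F -> computes enc (fun x => trunc_log 2 (F x)).
Proof.
apply: computes_comp; apply: (computes_min (fun i n => iter i.+1 half n)).
- move=> n; rewrite iter_half divn_small //.
  by case: n => [//|n]; have /andP[] := trunc_log_bounds (isT : 1 < 2)%N (ltn0Sn n).
- move=> [|n] i; first by rewrite trunc_log0.
  move=> i_lt; rewrite iter_half divn_gt0 ?expn_gt0 //.
  have /andP[le_n _] := trunc_log_bounds (isT : 1 < 2)%N (ltn0Sn n).
  by apply: leq_trans le_n; rewrite leq_exp2l.
- exact: computes_iter_half (computes_succ computes_fst) computes_snd.
Qed.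

(* Halving the code of a situation drops its last outcome, so for [c] the code
   of [s] this is a product over the initial segments of [s], provided that
   [G 0 = 1]: the indices [j > size s] give [iter j half c = 0]. *)
Definition branch_prod (G : nat -> nat) (c : nat) : nat :=
  \prod_(j < c) G (iter j half c).

Lemma computes_branch_prod {X : Type} {enc : X -> seq nat} {G : nat -> nat}
    {F : X -> nat} :
  computes (fun n => [:: n]) G -> computes enc F ->
  computes enc (fun x => branch_prod G (F x)).
Proof.
move=> GP; apply: computes_comp.
(* The code is both the length of the product and a parameter of its factors; separating the two
   roles gives a primitive recursion in [n], used on the diagonal. *)
pose H n c := (\prod_(j < n) G (iter j half c))%N.
apply: (computes_comp2 (F := H) _ computes_id computes_id).
apply: (computes_prim2 (H := H) (fun n z c => z * G (iter n half c))%N).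
- by move=> n c; rewrite /H big_ord_recr.
- by apply: eq_computes (computes_const _ 1) => c; rewrite /H big_ord0.
- apply: computes_mul computes_acc (computes_comp GP _).
  by apply: computes_iter_half computes_param; apply: (computes_nth enc3 0).
Qed.

Lemma branch_prod1 (G : nat -> nat) : branch_prod G 1 = G 1%N.
Proof. by rewrite /branch_prod big_ord1. Qed.

(** Index 0 gives the factor of the child itself. After one halving, the other indices give the
    factors of [c], followed by surplus ones read at 0, where [G] is 1. *)
Lemma branch_prod_child (G : nat -> nat) (c : nat) (x : bool) :
  G 0%N = 1%N -> (0 < c)%N ->
  branch_prod G (c.*2 + x) = (branch_prod G c * G (c.*2 + x))%N.
Proof.
move=> G0 c_gt0; rewrite /branch_prod.
have [d cE] : exists d, (c.*2 + x = (c + d).+1)%N.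
  by exists (c + x).-1; lia.
have half_cE : (c.*2 + x)./2 = c by rewrite addnC half_bit_double.
rewrite cE big_ord_recl /= -cE mulnC; congr (_ * _)%N.
under eq_bigr => j _ do rewrite -iterS iterSr half_cE.
rewrite big_split_ord /= [X in (_ * X)%N]big1 ?muln1 // => j _.
rewrite iter_half divn_small // (leq_trans (ltn_expl c (isT : 1 < 2)%N)) //.
by rewrite leq_exp2l // leq_addr.
Qed.

Lemma branch_prod_gt0 (G : nat -> nat) (c : nat) :
  (forall d, 0 < G d)%N -> (0 < branch_prod G c)%N.
Proof. by move=> G_gt0; rewrite prodn_gt0. Qed.

(** * Codes of situations *)

Lemma situation_code_rcons (s : situation) (x : bool) :
  situation_code (rcons s x) = ((situation_code s).*2 + x)%N.
Proof. by rewrite /situation_code foldl_rcons. Qed.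

Lemma situation_code_bounds (s : situation) :
  (2 ^ size s <= situation_code s < 2 ^ (size s).+1)%N.
Proof.
elim/last_ind: s => [//|s x].
rewrite situation_code_rcons size_rcons !expnS; case: x; lia.
Qed.

Lemma situation_code_gt0 (s : situation) : (0 < situation_code s)%N.
Proof.
by have /andP[+ _] := situation_code_bounds s; apply: leq_trans; rewrite expn_gt0.
Qed.

Lemma trunc_log_situation_code (s : situation) :
  trunc_log 2 (situation_code s) = size s.
Proof. exact: trunc_log_eq (situation_code_bounds s). Qed.

Local Notation enc_sit :=
  (fun t : situation * nat => [:: situation_code t.1; t.2]).

Lemma computable_natP (a : situation -> nat -> nat) :
  computable_nat a <-> computes enc_sit (fun t => a t.1 t.2).
Proof.
split=> -[f fP]; exists f; first by case=> s n; apply: fP.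
by move=> s n; apply: (fP (s, n)).
Qed.

Lemma computes_code : computes enc_sit (fun t => situation_code t.1).
Proof. exact: (computes_nth enc_sit 0). Qed.

Local Open Scope ring_scope.

(** * Upper expectations and boundedness along a sequence *)

Lemma upper_expectation_le {R : realType} (I : interval_forecast R)
    (f : bool -> R) (a : R) :
  (forall p, imin I <= p <= imax I -> p * f true + (1 - p) * f false <= a) ->
  upper_expectation I f <= a.
Proof.
move=> f_le; apply: ge_sup => [|_ [p p_I <-]]; last first.
  by apply: f_le; move: p_I; rewrite /forecast_set /= in_itv.
exists (imin I * f true + (1 - imin I) * f false), (imin I) => //.
by rewrite /forecast_set /= in_itv /= lexx imin_le_imax.
Qed.

Lemma upper_expectation_ge {R : realType} (I : interval_forecast R)
    (f : bool -> R) (p : R) :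
  imin I <= p <= imax I ->
  p * f true + (1 - p) * f false <= upper_expectation I f.
Proof.
move=> p_I; apply: ub_le_sup; last first.
  by exists p => //; rewrite /forecast_set /= in_itv.
(* The supremum is known to be an upper bound only for a set that is bounded above; this bound holds
   because the weights lie in [[0, 1]]. *)
exists (`|f true| + `|f false|) => _ [q + <-].
rewrite /forecast_set /= in_itv /= => /andP[q_ge q_le].
have q0 := le_trans (imin_ge0 I) q_ge; have q1 := le_trans q_le (imax_le1 I).
have := ler_norm (f true); have := ler_norm (f false).
have := normr_ge0 (f true); have := normr_ge0 (f false); nra.
Qed.

Lemma ereal_sup_ltyP {R : realType} (u : nat -> R) :
  (ereal_sup [set (u n)%:E | n in [set n | (0 < n)%N]] < +oo)%E <->
  exists B, forall n, u n <= B.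
Proof.
split=> [|[B u_le]]; last first.
  apply: (@le_lt_trans _ _ B%:E); last exact: ltry.
  by apply: ge_ereal_sup => _ [n _ <-]; rewrite lee_fin.
set S := [set _ | n in _]%classic => sup_lt.
have ub n : (0 < n)%N -> ((u n)%:E <= ereal_sup S)%E.
  by move=> n_gt0; apply: ereal_sup_ubound; exists n.
(* The value [u 1] excludes the supremum -oo, the hypothesis excludes +oo. The supremum ignores
   index 0, hence the maximum with [u 0] below. *)
have ub1 := ub 1%N isT; move: ub1 sup_lt ub; case: (ereal_sup S) => //= r _ _ ub.
exists (Num.max (u 0%N) r) => -[|n]; rewrite le_max ?lexx //.
by have := ub n.+1 isT; rewrite lee_fin => ->; rewrite orbT.
Qed.

(** * Processes that are products of rational factors *)

(** Numerators and denominators are accumulated separately, since programs handle natural numbers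
    only. *)
Definition ratio_process (R : realType) (num den : nat -> nat) :
    real_process R :=
  fun s => (branch_prod num (situation_code s))%:R /
           (branch_prod den (situation_code s))%:R.

Lemma ratio_process_rcons {R : realType} {num den : nat -> nat}
    (s : situation) (x : bool) :
  num 0%N = 1%N -> den 0%N = 1%N ->
  ratio_process R num den (rcons s x) =
  ratio_process R num den s *
  ((num (situation_code (rcons s x)))%:R / (den (situation_code (rcons s x)))%:R).
Proof.
move=> num0 den0; rewrite /ratio_process situation_code_rcons.
rewrite !branch_prod_child ?situation_code_gt0 // !natrM mulf_div //.
Qed.

Lemma ratio_process_nil {R : realType} {num den : nat -> nat} :
  num 1%N = 1%N -> den 1%N = 1%N -> ratio_process R num den [::] = 1.
Proof.
by move=> num1 den1; rewrite /ratio_process !branch_prod1 num1 den1 divr1.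
Qed.

Lemma computable_ratio_process {R : realType} {num den : nat -> nat} :
  computes (fun n => [:: n]) num -> computes (fun n => [:: n]) den ->
  (forall d, 0 < den d)%N -> computable_process (ratio_process R num den).
Proof.
move=> numP denP den_gt0.
pose a (s : situation) (n : nat) := branch_prod num (situation_code s).
pose b (s : situation) (n : nat) := branch_prod den (situation_code s).
exists (fun s n => (a s n)%:R / (b s n)%:R), (fun _ _ => 0%N); split.
- exists a, b, (fun _ _ => 0%N); split.
  + by apply/computable_natP/computes_branch_prod => //; apply: computes_code.
  + by apply/computable_natP/computes_branch_prod => //; apply: computes_code.
  + exact/computable_natP/computes_const.
  + by move=> s n; rewrite branch_prod_gt0 // expr0 mul1r.
- exact/computable_natP/computes_const.
- move=> s n N _; rewrite fmorph_div /= !ratr_nat subrr normr0.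
  by rewrite invr_ge0 exprn_ge0.
Qed.

(** It suffices that the next factor has expectation at most 1 under every probability in the
    forecast. The conditions at 0 neutralize the padding of [branch_prod]; those at 1, the code of
    the empty situation, give the initial value. *)
Lemma test_ratio_process {R : realType} (gamma : forecasting_system R)
    {num den : nat -> nat} :
  num 0%N = 1%N -> den 0%N = 1%N -> num 1%N = 1%N -> den 1%N = 1%N ->
  (forall s, let rho x : R := (num (situation_code (rcons s x)))%:R /
                              (den (situation_code (rcons s x)))%:R in
    forall p, imin (gamma s) <= p <= imax (gamma s) ->
    p * rho true + (1 - p) * rho false <= 1) ->
  test_supermartingale gamma (ratio_process R num den).
Proof.
move=> num0 den0 num1 den1 rho_le; split=> [s|s|].
- apply: upper_expectation_le => p /rho_le /= rho_le1.
  rewrite /process_difference !ratio_process_rcons //.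
  move: rho_le1; set x := _ / _; set y := _ / _ => rho_le1.
  set r := ratio_process _ _ _ _.
  have r0 : 0 <= r by rewrite divr_ge0.
  have := mulr_ge0 r0 (_ : 0 <= 1 - (p * x + (1 - p) * y)).
  by rewrite subr_ge0 => /(_ rho_le1); lra.
- by rewrite divr_ge0.
- exact: ratio_process_nil.
Qed.

(** * Integer stakes and the factors of the two betting processes *)

Lemma stake_exists (k : nat) : exists m, (6 * k <= m * m)%N.
Proof. by exists (6 * k)%N; case: k => // k; nia. Qed.

(* The reciprocal [1 / stake k] is the fraction of the capital bet at time [k]:
   small enough to be at most [delta k], yet not square summable. *)
Definition stake (k : nat) : nat := ex_minn (stake_exists k).

Lemma stake_lb (k : nat) : (6 * k <= stake k * stake k)%N.
Proof. by rewrite /stake; case: ex_minnP. Qed.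

Lemma stake_min (k m : nat) : (6 * k <= m * m)%N -> (stake k <= m)%N.
Proof. by rewrite /stake; case: ex_minnP => n _; apply. Qed.

Lemma stake_gt2 (k : nat) : (0 < k)%N -> (2 < stake k)%N.
Proof. by have := stake_lb k; nia. Qed.

(** With [m = stake k], minimality gives [(m - 1)^2 < 6 k], and [m <= 2 (m - 1)]; hence the constant
    24. *)
Lemma stake_ub (k : nat) : (0 < k)%N -> (stake k * stake k <= 24 * k)%N.
Proof.
move=> k_gt0; have m_gt2 := stake_gt2 k k_gt0.
have : ~~ (6 * k <= (stake k).-1 * (stake k).-1)%N.
  by apply/negP => /stake_min; lia.
by move: (stake k) m_gt2 => [//|m] /=; nia.
Qed.

Lemma computes_stake {X : Type} {enc : X -> seq nat} {F : X -> nat} :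
  computes enc F -> computes enc (fun x => stake (F x)).
Proof.
apply: computes_comp; apply: (computes_min (fun m k => 6 * k - m * m)%N).
- by move=> k; have := stake_lb k; lia.
- move=> k m m_lt; rewrite subn_gt0 ltnNge; apply/negP => /stake_min.
  by rewrite leqNgt m_lt.
- apply: computes_sub; apply: computes_mul; try exact: computes_fst.
    exact: computes_const.
  exact: computes_snd.
Qed.

(* If [d] is the code of [z_1 ... z_k], then [trunc_log 2 d = k] and [odd d] is
   [z_k]; the bet is on the outcome [~~ b] at the times [k] of parity [b].  The
   codes [0] and [1] correspond to no time. *)
Definition bet_time (b : bool) (d : nat) : bool :=
  (1 < d)%N && (odd (trunc_log 2 d) == b).

Lemma bet_time_rcons (b : bool) (s : situation) (x : bool) :
  bet_time b (situation_code (rcons s x)) = (odd (size s).+1 == b).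
Proof.
rewrite /bet_time trunc_log_situation_code size_rcons.
rewrite situation_code_rcons; have := situation_code_gt0 s.
by case: ltnP => //; lia.
Qed.

Definition bet_num (b : bool) (d : nat) : nat :=
  if bet_time b d then
    if odd d == b then (stake (trunc_log 2 d)).-1 else (stake (trunc_log 2 d)).+1
  else 1.

Definition bet_den (b : bool) (d : nat) : nat :=
  if bet_time b d then stake (trunc_log 2 d) else 1.

(** For [c = 1 / m], this is the numerator of [(1 + c^2) / (1 + c)] and [(1 + c^2) / (1 - c)],
    written as [(m^2 + 1) / (m (m + 1))] and [(m^2 + 1) / (m (m - 1))]. *)
Definition witness_num (b : bool) (d : nat) : nat :=
  if bet_time b d then (stake (trunc_log 2 d) * stake (trunc_log 2 d)).+1 else 1.

Definition witness_den (b : bool) (d : nat) : nat := bet_num b d * bet_den b d.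

Lemma bet_time_stake (b : bool) (d : nat) :
  bet_time b d -> (2 < stake (trunc_log 2 d))%N.
Proof. by case/andP => d_gt1 _; rewrite stake_gt2 // trunc_log_gt0. Qed.

Lemma bet_num_gt0 (b : bool) (d : nat) : (0 < bet_num b d)%N.
Proof.
rewrite /bet_num; case: ifP => // /bet_time_stake; case: ifP => // _; lia.
Qed.

Lemma bet_den_gt0 (b : bool) (d : nat) : (0 < bet_den b d)%N.
Proof. by rewrite /bet_den; case: ifP => // /bet_time_stake; lia. Qed.

Lemma computes_bet_time (b : bool) :
  computes (fun n => [:: n]) (fun d => nat_of_bool (bet_time b d)).
Proof.
apply: (eq_computes
  (F := fun d => if (1 < d)%N then nat_of_bool (odd (trunc_log 2 d) == b) else 0%N)).
  by move=> d; rewrite /bet_time; case: (1 < d)%N.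
apply: computes_if; last exact: computes_const.
  exact: computes_leq (computes_const _ _) computes_id.
apply: (computes_bool (fun x => nat_of_bool (x == b))).
exact: computes_odd (computes_log2 computes_id).
Qed.

Lemma computes_stake_log2 :
  computes (fun n => [:: n]) (fun d => stake (trunc_log 2 d)).
Proof. exact: computes_stake (computes_log2 computes_id). Qed.

Lemma computes_bet_num (b : bool) : computes (fun n => [:: n]) (bet_num b).
Proof.
apply: computes_if (computes_bet_time b) _ (computes_const _ _).
apply: computes_if.
- apply: (computes_bool (fun x => nat_of_bool (x == b))).
  exact: computes_odd computes_id.
- exact: computes_pred computes_stake_log2.
- exact: computes_succ computes_stake_log2.
Qed.

Lemma computes_bet_den (b : bool) : computes (fun n => [:: n]) (bet_den b).
Proof.
exact: computes_if (computes_bet_time b) computes_stake_log2 (computes_const _ _).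
Qed.

Lemma computes_witness_num (b : bool) :
  computes (fun n => [:: n]) (witness_num b).
Proof.
apply: computes_if (computes_bet_time b) _ (computes_const _ _).
by apply/computes_succ/computes_mul; apply: computes_stake_log2.
Qed.

(** * Estimates for [delta], made on its square *)

Lemma delta_sqr {R : realType} (n : nat) :
  let q : R := expR (- (n.+1%:R)^-1) in delta R n ^+ 2 = q * (1 - q).
Proof.
move=> q; have qE : q * expR (n.+1%:R)^-1 = 1 by rewrite /q -expRD addNr expR0.
rewrite /delta exprMn sqr_sqrtr -/q; last first.
  by rewrite subr_ge0 -[leLHS]expR0 ler_expR invr_ge0.
rewrite -[in RHS]qE; ring.
Qed.

(** With [x = 1 / (n + 1)] and [q = exp (- x)], one has [q (1 - q) <= 1 - q <= x]. *)
Lemma delta_sqr_ub {R : realType} (n : nat) :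
  delta R n ^+ 2 <= (n.+1%:R)^-1.
Proof.
rewrite delta_sqr; have x0 : 0 <= (n.+1%:R : R)^-1 by rewrite invr_ge0.
move: (_^-1) x0 => x x0.
have q_ge := expR_ge1Dx (- x); have q_ge0 := expR_ge0 (- x).
have : expR (- x) <= 1 by rewrite -[leRHS]expR0 ler_expR; lra.
nra.
Qed.

(** The bounds [1 - x <= q <= 1 / (1 + x)] lead to [q (1 - q) >= t / ((t + 1) (t + 2))] with
    [t = n]. The constant 6 comes from [(t + 1) (t + 2) <= 6 t^2] for [t >= 1], an equality at 1. *)
Lemma delta_sqr_lb {R : realType} (n : nat) :
  (0 < n)%N -> (6 * n)%:R^-1 <= delta R n ^+ 2.
Proof.
move=> n_gt0; rewrite delta_sqr natrM -(natr1 n).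
have : 1 <= n%:R :> R by rewrite ler1n.
move: (n%:R) => t t1; set x : R := (t + 1)^-1; set q := expR (- x).
have tx : (t + 1) * x = 1 by rewrite mulfV //; lra.
have x0 : 0 < x by rewrite invr_gt0; lra.
have qE : q * expR x = 1 by rewrite -expRD addNr expR0.
have q_ge : 1 - x <= q by exact: expR_ge1Dx.
have q0 : 0 < q by exact: expR_gt0.
have q_le : q * (1 + x) <= 1.
  by rewrite -[leRHS]qE ler_pM2l //; apply: expR_ge1Dx.
(* The right side equals [x q + q (1 - q (1 + x))]. *)
have low : x * (1 - x) <= (1 + x) * (q * (1 - q)).
  have : x * (1 - x) <= x * q by rewrite ler_pM2l.
  have : 0 <= q * (1 - q * (1 + x)) by apply: mulr_ge0; [exact: ltW | lra].
  lra.
rewrite -div1r ler_pdivrMr; last lra.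
suff: (t + 1) * (t + 2) <= (t + 1) * (t + 2) * (q * (1 - q) * (6 * t)).
  by rewrite -[leLHS]mulr1 ler_pM2l //; apply: mulr_gt0; lra.
have low' : t <= (t + 1) * (t + 2) * (q * (1 - q)).
  have -> : (t + 1) * (t + 2) * (q * (1 - q)) =
            (t + 1) ^+ 2 * ((1 + x) * (q * (1 - q))).
    transitivity ((t + 1) * ((t + 1) + (t + 1) * x) * (q * (1 - q))).
      by rewrite tx; ring.
    ring.
  apply: (@le_trans _ _ ((t + 1) ^+ 2 * (x * (1 - x)))).
    have -> : (t + 1) ^+ 2 * (x * (1 - x)) =
      (t + 1) * x * (t + 1 - (t + 1) * x) by ring.
    by rewrite tx; lra.
  by rewrite ler_pM2l // exprn_gt0; lra.
nra.
Qed.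

(** This is [c_k <= delta_k] for [c_k = 1 / stake k], obtained by comparing squares. *)
Lemma stake_delta {R : realType} (k : nat) :
  (0 < k)%N -> 1 <= (stake k)%:R * delta R k.
Proof.
move=> k_gt0; rewrite -(@ler_pXn2r _ 2) ?nnegrE ?mulr_ge0 ?delta_ge0 //.
rewrite expr1n exprMn.
have k6 : 0 < (6 * k)%:R :> R by rewrite ltr0n muln_gt0.
apply: (@le_trans _ _ ((6 * k)%:R * (6 * k)%:R^-1)).
  by rewrite mulfV // gt_eqF.
apply: ler_pM (delta_sqr_lb k k_gt0) => //.
by rewrite -natrX ler_nat expnS expn1 stake_lb.
Qed.

(** * The two betting processes and the divergence of their product *)

Definition wealth (R : realType) (b : bool) : real_process R :=
  ratio_process R (bet_num b) (bet_den b).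

Definition witness (R : realType) (b : bool) : real_process R :=
  ratio_process R (witness_num b) (witness_den b).

Lemma computable_wealth (R : realType) (b : bool) :
  computable_process (wealth R b).
Proof.
apply: computable_ratio_process (bet_den_gt0 b).
  exact: computes_bet_num.
exact: computes_bet_den.
Qed.

Lemma computable_witness (R : realType) (b : bool) :
  computable_process (witness R b).
Proof.
apply: computable_ratio_process.
- exact: computes_witness_num.
- exact: computes_mul (computes_bet_num b) (computes_bet_den b).
- by move=> d; rewrite muln_gt0 bet_num_gt0 bet_den_gt0.
Qed.

Lemma wealth_ratio {R : realType} (b : bool) (s : situation) (x : bool) :
  let d := situation_code (rcons s x) in
  (bet_num b d)%:R / (bet_den b d)%:R =
  if odd (size s).+1 == b then
    1 + (if x == b then -1 else 1) / (stake (size s).+1)%:R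
  else 1 :> R.
Proof.
rewrite /bet_num /bet_den bet_time_rcons.
rewrite trunc_log_situation_code size_rcons.
case: eqP => _; last by rewrite divr1.
have m_gt2 := stake_gt2 (size s).+1 isT.
have m0 : (stake (size s).+1)%:R != 0 :> R by rewrite pnatr_eq0; lia.
rewrite situation_code_rcons oddD odd_double addFb oddb.
case: eqP => _; last by rewrite -natr1; field.
rewrite -(subn1 (stake _)) natrB ?(ltnW (ltnW m_gt2)) //; field; exact: m0.
Qed.

Lemma witness_ratio {R : realType} (b : bool) (s : situation) (x : bool) :
  let d := situation_code (rcons s x) in
  let m : R := (stake (size s).+1)%:R in
  (witness_num b d)%:R / (witness_den b d)%:R =
  if odd (size s).+1 == b then
    (m ^+ 2 + 1) / (m * (m + (if x == b then -1 else 1)))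
  else 1.
Proof.
rewrite /witness_den /witness_num /bet_num /bet_den bet_time_rcons.
rewrite trunc_log_situation_code size_rcons.
case: eqP => _; last by rewrite divr1.
have m_gt2 := stake_gt2 (size s).+1 isT.
rewrite situation_code_rcons oddD odd_double addFb oddb.
rewrite -natr1 natrM expr2 natrM; congr (_ / _).
rewrite mulrC; congr (_ * _); case: eqP => _; last by rewrite natr1.
by rewrite -(subn1 (stake _)) natrB // (ltnW (ltnW m_gt2)).
Qed.

(** At a betting time the expected factor is [1 + c (1 - 2 p)] for [b = true] and [1 + c (2 p - 1)]
    for [b = false]. *)
Lemma test_wealth {R : realType} (I : interval_forecast R) (b : bool) :
  (if b then 2^-1 <= imin I else imax I <= 2^-1) ->
  test_supermartingale (stationary I) (wealth R b).
Proof.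
move=> half_I; apply: test_ratio_process => // s rho p /andP[p_ge p_le].
rewrite {}/rho !wealth_ratio; case: ifP => _; last by lra.
have c0 : 0 <= (stake (size s).+1)%:R^-1 :> R by rewrite invr_ge0.
move: (_^-1) c0 => c c0; rewrite /stationary in p_ge p_le.
by case: b half_I => /= half_I; nra.
Qed.

(** At times of parity [b], the outcome [b], on which the bet loses, has probability [1/2 - d] under
    [gamma_half]; so this one inequality serves both parities. *)
Lemma witness_step {R : realType} (m d : R) :
  1 < m -> 1 <= m * d ->
  (2^-1 - d) * ((m ^+ 2 + 1) / (m * (m - 1))) +
  (2^-1 + d) * ((m ^+ 2 + 1) / (m * (m + 1))) <= 1.
Proof.
move=> m1 md1; have m0 : m != 0 by apply/eqP; lra.
have m1' : m - 1 != 0 by apply/eqP; lra.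
have m1'' : m + 1 != 0 by apply/eqP; lra.
have -> : (2^-1 - d) * ((m ^+ 2 + 1) / (m * (m - 1))) +
  (2^-1 + d) * ((m ^+ 2 + 1) / (m * (m + 1))) =
  (m ^+ 2 + 1) * (m - 2 * d) / (m * (m - 1) * (m + 1)).
  by field; rewrite m0 m1' m1''.
have den_gt0 : 0 < m * (m - 1) * (m + 1).
  by apply: mulr_gt0; [apply: mulr_gt0|]; lra.
rewrite ler_pdivrMr // mul1r.
(* After clearing denominators the claim is [0 <= m (m d - 1) + d]. *)
have : 0 <= m * (m * d - 1) by apply: mulr_ge0; lra.
have : 0 < d by rewrite -(pmulr_rgt0 _ (_ : 0 < m)); lra.
rewrite expr2; lra.
Qed.

Lemma test_witness (R : realType) (b : bool) :
  test_supermartingale (gamma_half R) (witness R b).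
Proof.
apply: test_ratio_process => // s rho p.
rewrite /gamma_half /= => p_eq.
have {p_eq} -> : p = forecast_p R (size s).+1 by apply/le_anti; rewrite andbC.
rewrite {}/rho !witness_ratio; case: ifP => [/eqP bE|_]; last by lra.
have m_gt2 := stake_gt2 (size s).+1 isT.
have m1 : 1 < (stake (size s).+1)%:R :> R by rewrite ltr1n; lia.
have := @witness_step R _ _ m1 (stake_delta (size s).+1 isT).
rewrite /forecast_p -signr_odd bE.
move: (stake _)%:R (delta _ _) => m d {bE m1}.
case: b => /=; rewrite ?expr1 ?expr0; lra.
Qed.

Lemma wealth_witness_rcons {R : realType} (b : bool) (s : situation) (x : bool) :
  wealth R b (rcons s x) * witness R b (rcons s x) =
  wealth R b s * witness R b s *
  (1 + (if odd (size s).+1 == b then (stake (size s).+1)%:R ^- 2 else 0)).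
Proof.
rewrite /wealth /witness !ratio_process_rcons // wealth_ratio witness_ratio.
rewrite mulrACA; congr (_ * _); case: ifP => _; last by rewrite mulr1 addr0.
have m_gt2 := stake_gt2 (size s).+1 isT.
have : 2 < (stake (size s).+1)%:R :> R by rewrite ltr_nat.
move: (stake _)%:R => m m2.
have m0 : m != 0 by apply/eqP; lra.
have m1 : m + 1 != 0 by apply/eqP; lra.
have m1' : m - 1 != 0 by apply/eqP; lra.
by case: ifP => _; field; rewrite ?m0 ?m1 ?m1'.
Qed.

(** The constant comes from [(stake k)^2 <= 24 k <= 48 (j + 1)]. *)
Lemma stake_sqr_lb {R : realType} (j k : nat) :
  (0 < k)%N -> (k <= 2 * j.+1)%N ->
  48^-1 * (j.+1%:R)^-1 <= (stake k)%:R ^- 2 :> R.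
Proof.
move=> k_gt0 k_le; have m_gt2 := stake_gt2 k k_gt0; have m_le := stake_ub k k_gt0.
rewrite -invfM lef_pV2 ?posrE ?exprn_gt0 ?mulr_gt0 ?ltr0n //; try lia.
by rewrite -natrX -natrM ler_nat expnS expn1; lia.
Qed.

(** Outcomes are taken in pairs: the times [2 n + 1] and [2 n + 2] include exactly one bet, whatever
    [b] is, so both parities share one harmonic lower bound. *)
Lemma wealth_witness_growth {R : realType} (b : bool) (omega : outcome_sequence)
    (n : nat) :
  1 + 48^-1 * series harmonic n <=
  wealth R b (initial omega n.*2) * witness R b (initial omega n.*2).
Proof.
elim: n => [|n IHn].
  rewrite /series /= big_geq // mulr0 addr0.
  by rewrite /wealth /witness !ratio_process_nil // mulr1.
rewrite seriesSr mulrDr addrA (_ : harmonic n = n.+1%:R^-1) //.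
rewrite doubleS /initial mkseqS mkseqS.
rewrite !wealth_witness_rcons size_rcons !size_mkseq /= odd_double.
have H1 := @stake_sqr_lb R n (n.*2).+1 isT ltac:(lia).
have H2 := @stake_sqr_lb R n (n.*2).+2 isT ltac:(lia).
have h0 : 0 <= 48^-1 * (n.+1%:R)^-1 :> R by rewrite mulr_ge0 ?invr_ge0.
have s0 : 0 <= 48^-1 * series harmonic n :> R.
  by rewrite mulr_ge0 // sumr_ge0 // => i _; apply: harmonic_ge0.
move: (48^-1 * n.+1%:R^-1) h0 H1 H2 => h h0 H1 H2.
move: IHn; rewrite /initial; move: (_ * series _ _) s0 (wealth _ _ _ * _) => S s0 P IHn.
have {IHn} step c : h <= c -> 1 + S + h <= P * (1 + c).
  have P1 : 0 <= P - 1 by lra.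
  by move=> c_ge; have := mulr_ge0 P1 (le_trans h0 c_ge); lra.
by case: b => /=; rewrite addr0 mulr1; apply: step.
Qed.

Lemma harmonic_unbounded (R : realType) (B : R) :
  exists n, B < series harmonic n.
Proof.
apply: contrapT => noP; apply: (@dvg_harmonic R).
apply: nondecreasing_is_cvgn.
  by apply/nondecreasing_seqP => n; rewrite seriesSr lerDl harmonic_ge0.
exists B => _ [n _ <-]; rewrite leNgt; apply/negP => B_lt.
by apply: noP; exists n.
Qed.

Lemma not_computably_random_stationary {R : realType} (b : bool)
    (omega : outcome_sequence) (I : interval_forecast R) :
  computably_random (gamma_half R) omega ->
  (if b then 2^-1 <= imin I else imax I <= 2^-1) ->
  ~ computably_random (stationary I) omega.
Proof.
move=> om_half half_I om_I.
have /ereal_sup_ltyP[B1 B1P] := om_I _ (computable_wealth R b) (test_wealth _ _ half_I).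
have /ereal_sup_ltyP[B2 B2P] :=
  om_half _ (computable_witness R b) (test_witness R b).
(* The factor 48 cancels that of the growth bound, which then exceeds [B1 * B2]. *)
have [n n_gt] := @harmonic_unbounded R (48 * (B1 * B2)).
have := wealth_witness_growth (R := R) b omega n.
apply/negP; rewrite -ltNge.
apply: (@le_lt_trans _ _ (B1 * B2)); last lra.
have [_ w0 _] := test_wealth _ _ half_I.
have [_ v0 _] := test_witness R b.
exact: ler_pM.
Qed.

(** * Intervals with 1/2 in their interior: delayed supermartingales *)

Lemma delta_small (R : realType) (e : R) :
  0 < e -> exists N, forall n, (N <= n)%N -> delta R n <= e.
Proof.
move=> e0; have [N] : exists N, (e ^+ 2)^-1 < N%:R.
  by exists (Num.bound (e ^+ 2)^-1); apply: archi_boundP; rewrite invr_ge0 sqr_ge0.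
move=> N_gt; exists N => n Nn.
rewrite -(@ler_pXn2r _ 2) ?nnegrE ?delta_ge0 ?(ltW e0) //.
apply: le_trans (delta_sqr_ub n) _.
have e2 : 0 < e ^+ 2 by rewrite exprn_gt0.
rewrite invf_ple ?posrE //; apply: le_trans (ltW N_gt) _.
by rewrite ler_nat leqW.
Qed.

(** Only finitely many situations have a given length. A natural bound is sought because dividing by
    it preserves computability. *)
Lemma bounded_above_size {R : realType} (F : situation -> R) (n : nat) :
  exists B : nat, forall s, size s = n -> F s <= B%:R.
Proof.
elim: n F => [|n IHn] F.
  exists (Num.bound `|F [::]|) => s /size0nil ->.
  by apply: le_trans (ler_norm _) _; apply/ltW/archi_boundP.
have [B0 B0P] := IHn (fun s => F (rcons s false)).
have [B1 B1P] := IHn (fun s => F (rcons s true)).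
exists (maxn B0 B1); case/lastP => [//|s x].
rewrite size_rcons => -[sE].
have [le0 le1] : (B0%:R : R) <= (maxn B0 B1)%:R /\ (B1%:R : R) <= (maxn B0 B1)%:R.
  by rewrite !ler_nat leq_maxl leq_maxr.
by case: x; [apply: le_trans (B1P _ sE) _ | apply: le_trans (B0P _ sE) _].
Qed.

(* Dividing by [K] lets the process [T] start at time [N] with capital at most
   [1], without knowing its computable values exactly. *)
Definition delayed {R : realType} (T : real_process R) (N K : nat) :
    real_process R :=
  fun s => if (size s < N)%N then 1 else T s / K%:R.

Lemma computable_delayed {R : realType} (T : real_process R) (N K : nat) :
  (0 < K)%N -> computable_process T -> computable_process (delayed T N K).
Proof.
move=> K_gt0 [r [e [[a [b [sg [aP bP sgP rE]]]] eP Tr]]].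
(* The delay is decided on the code, without computing the length. *)
have size_ltE (s : situation) : (situation_code s < 2 ^ N)%N = (size s < N)%N.
  have /andP[lo hi] := situation_code_bounds s.
  case: (ltnP (size s) N) => [sN|Ns].
    by rewrite (leq_trans hi) // leq_exp2l.
  by apply/negbTE; rewrite -leqNgt (leq_trans _ lo) // leq_exp2l.
have early (f : situation -> nat -> nat) c : computable_nat f ->
    computable_nat (fun s n => if (size s < N)%N then c else f s n).
  move=> /computable_natP fP; apply/computable_natP.
  apply: computes_if (computes_const _ _) fP.
  apply: (eq_computes (F := fun t => nat_of_bool (situation_code t.1 < 2 ^ N)%N)).
    by move=> t; rewrite size_ltE.
  exact: computes_leq (computes_succ computes_code) (computes_const _ _).
exists (fun s n => if (size s < N)%N then 1 else r s n / K%:R), e; split=> //.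
- exists (fun s n => if (size s < N)%N then 1%N else a s n).
  exists (fun s n => if (size s < N)%N then 1%N else b s n * K)%N.
  exists (fun s n => if (size s < N)%N then 0%N else sg s n).
  split; try exact: early.
    apply: early; apply/computable_natP.
    by apply: computes_mul (computes_const _ _); apply/computable_natP.
  move=> s n; have [b_gt0 rsn] := rE s n; case: ifP => _.
    by rewrite expr0 mul1r divr1.
  by split; rewrite ?muln_gt0 ?b_gt0 // rsn natrM invfM !mulrA.
- move=> s n M le_n; rewrite /delayed; case: ifP => _.
    by rewrite rmorph1 subrr normr0 invr_ge0 exprn_ge0.
  (* Division by [K >= 1] does not enlarge the error, so the modulus [e] still works. *)
  rewrite fmorph_div /= ratr_nat -mulrBl normrM normfV normr_nat.
  apply: le_trans (Tr s n M le_n); apply: ler_piMr => //.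
  by rewrite invf_le1 ?ltr0n // ler1n.
Qed.

(** There are three regimes: constant 1 at first; then a step from 1 to [T / K <= 1] on reaching
    length [N]; afterwards a multiple of [T], where the forecasts of [gamma'] lie within those of
    [gamma]. *)
Lemma test_delayed {R : realType} (gamma gamma' : forecasting_system R)
    (T : real_process R) (N K : nat) :
  (0 < N)%N -> (0 < K)%N -> (forall s, size s = N -> T s <= K%:R) ->
  (forall s, (N <= size s)%N ->
     imin (gamma s) <= imin (gamma' s) /\ imax (gamma' s) <= imax (gamma s)) ->
  test_supermartingale gamma T ->
  test_supermartingale gamma' (delayed T N K).
Proof.
move=> N_gt0 K_gt0 T_le sub [T_super T_ge0 T_1].
have K0 : 0 < K%:R :> R by rewrite ltr0n.
split=> [s|s|]; last by rewrite /delayed N_gt0.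
- apply: upper_expectation_le => p /andP[p_ge p_le].
  rewrite /process_difference /delayed !size_rcons.
  have p0 := le_trans (imin_ge0 _) p_ge; have p1 := le_trans p_le (imax_le1 _).
  case: (ltnP (size s) N) => sN; last first.
    rewrite ltnNge (leqW sN) /=.
    have [sub1 sub2] := sub s sN.
    have := @upper_expectation_ge R (gamma s) (process_difference T s) p.
    rewrite (le_trans sub1) ?(le_trans p_le) // => /(_ isT) /le_trans.
    move=> /(_ _ (T_super s)); rewrite /process_difference => le0.
    rewrite -!mulrBl !mulrA -mulrDl pmulr_lle0 ?invr_gt0 //.
  case: ltnP => Ns; first by lra.
  have sE x : size (rcons s x) = N by rewrite size_rcons; lia.
  have le1 x : T (rcons s x) / K%:R <= 1 by rewrite ler_pdivrMr // mul1r T_le.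
  have := le1 true; have := le1 false; nra.
- by rewrite /delayed; case: ifP => // _; rewrite divr_ge0.
Qed.

Lemma forecast_p_eventually {R : realType} (I : interval_forecast R) :
  imin I < 2^-1 -> 2^-1 < imax I ->
  exists N, forall n, (N <= n)%N -> imin I <= forecast_p R n <= imax I.
Proof.
move=> lo hi.
have [N1 N1P] := delta_small R (2^-1 - imin I) ltac:(lra).
have [N2 N2P] := delta_small R (imax I - 2^-1) ltac:(lra).
exists (maxn N1 N2) => n; rewrite geq_max => /andP[/N1P d1 /N2P d2].
have d0 := delta_ge0 R n; rewrite /forecast_p -signr_odd.
by case: (odd n); rewrite ?expr1 ?expr0; apply/andP; split; lra.
Qed.

Lemma computably_random_stationary {R : realType} (omega : outcome_sequence)
    (I : interval_forecast R) :
  computably_random (gamma_half R) omega -> imin I < 2^-1 -> 2^-1 < imax I ->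
  computably_random (stationary I) omega.
Proof.
move=> om_half lo hi T T_comp T_test.
have [N pN] := forecast_p_eventually I lo hi.
(* Starting at [N.+1] and dividing by [K0.+1] ensures that delay and divisor are positive. *)
have [K0 K0P] := bounded_above_size T N.+1.
have K_ge s : size s = N.+1 -> T s <= K0.+1%:R.
  by move=> /K0P /le_trans; apply; rewrite ler_nat.
have D_comp := computable_delayed T N.+1 K0.+1 isT T_comp.
have D_test : test_supermartingale (gamma_half R) (delayed T N.+1 K0.+1).
  apply: test_delayed T_test => // s Ns.
  by apply/andP; apply: pN; apply: leqW; apply: ltnW.
have /ereal_sup_ltyP[B BP] := om_half _ D_comp D_test.
apply/ereal_sup_ltyP.
have Kp : 0 < K0.+1%:R :> R by rewrite ltr0n.
have late n : (N < n)%N -> T (initial omega n) <= B * K0.+1%:R.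
  move=> Nn; have := BP n; rewrite /delayed size_mkseq ltnNge Nn /=.
  by rewrite ler_pdivrMr.
(* As [T] is non-negative, the sum of its finitely many early values bounds each of them. *)
pose M := \sum_(i < N.+1) T (initial omega i).
have [_ T0 _] := T_test.
exists (Num.max (B * K0.+1%:R) M) => n; rewrite le_max.
case: (ltnP N n) => [/late -> //|nN]; apply/orP; right.
have nN' : (n < N.+1)%N by [].
by rewrite /M (bigD1 (Ordinal nN')) //= lerDl sumr_ge0.
Qed.

Theorem proposition15 (R : realType) (omega : outcome_sequence)
    (omega_random : computably_random (gamma_half R) omega)
    (I : interval_forecast R) :
  computable_forecasts omega I <-> imin I < 2^-1 /\ 2^-1 < imax I.
Proof.
split=> [om_I|[lo hi]]; last exact: computably_random_stationary.
split; rewrite ltNge; apply/negP => half_I.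
  exact: (not_computably_random_stationary true _ I omega_random half_I).
exact: (not_computably_random_stationary false _ I omega_random half_I).
Qed.
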